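(* Let $(\mathcal K,\mathcal O,\vartriangleleft)$ be a bicontinuous bi-dcpo. (1) Suppose that the poset $\mathcal O$ has binary meets and binary joins. Then the bi-dcpo $(\mathcal K,\mathcal O,\vartriangleleft)$ is distributive if and only if the lattice $\mathcal O$ is distributive. (2) Suppose that the poset $\mathcal K$ has binary joins and binary meets. Then the bi-dcpo $(\mathcal K,\mathcal O,\vartriangleleft)$ is distributive if and only if the lattice $\mathcal K$ is distributive.
   Context: Directed: nonempty and every two elements have an upper bound in the set; codirected is the order dual. Polarity: a triple $(\mathcal K,\mathcal O,\vartriangleleft)$ of two sets and a relation $\vartriangleleft$ from $\mathcal K$ to $\mathcal O$. Put ${\uparrow_{\mathcal O}}k=\{u\in\mathcal O\mid k\vartriangleleft u\}$, ${\downarrow_{\mathcal K}}u=\{k\in\mathcal K\mid k\vartriangleleft u\}$. Specialization preorders: $k\le l$ iff ${\uparrow_{\mathcal O}}k\supseteq{\uparrow_{\mathcal O}}l$; $u\le v$ iff ${\downarrow_{\mathcal K}}u\subseteq{\downarrow_{\mathcal K}}v$. The polarity is purified if both are partial orders; $\mathcal K$ and $\mathcal O$ are then regarded as posets with these orders. Put ${\downarrow_{\mathcal K}}k=\{l\in\mathcal K\mid l\le k\}$, ${\uparrow_{\mathcal O}}u=\{v\in\mathcal O\mid u\le v\}$. Bi-dcpo: a purified polarity such that $\mathcal K$ has all codirected meets and $\mathcal O$ all directed joins; if $k\vartriangleleft\bigvee I$ with $k\in\mathcal K$ and $I\subseteq\mathcal O$ directed, then $k\vartriangleleft u$ for some $u\in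 I$; and if $\bigwedge F\vartriangleleft u$ with $u\in\mathcal O$ and $F\subseteq\mathcal K$ codirected, then $k\vartriangleleft u$ for some $k\in F$. A bi-dcpo is distributive if for all $k,l\in\mathcal K$, $u,v\in\mathcal O$: whenever (i) $k\vartriangleleft w$ for all $w\in{\uparrow_{\mathcal O}}u\cap{\uparrow_{\mathcal O}}l$, (ii) $l\vartriangleleft v$, and (iii) $m\vartriangleleft u$ for all $m\in{\downarrow_{\mathcal K}}v\cap{\downarrow_{\mathcal K}}k$, then $k\vartriangleleft u$. For $u\in\mathcal O$, $k\in\mathcal K$ write $u\blacktriangleleft k$ iff ${\downarrow_{\mathcal K}}u\subseteq{\downarrow_{\mathcal K}}k$. A bi-dcpo is locally compact if $k\vartriangleleft u$ implies that there are $u'\in\mathcal O$, $k'\in\mathcal K$ with $k\vartriangleleft u'\blacktriangleleft k'\vartriangleleft u$; it is bicontinuous if it is locally compact, ${\downarrow_{\mathcal K}}u$ is directed for every $u\in\mathcal O$, and ${\uparrow_{\mathcal O}}k$ is codirected for every $k\in\mathcal K$. Lattices are not assumed bounded. *)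

(* Defs.v *)
From Stdlib Require Relation_Definitions.
From mathcomp Require Import ssreflect ssrfun ssrbool.
From mathcomp Require Import boolp classical_sets.

Set Implicit Arguments.
Unset Strict Implicit.
Unset Printing Implicit Defensive.

Local Open Scope classical_set_scope.

Section Orders.
Variables (T : Type) (le : T -> T -> Prop).

Definition directed (A : set T) : Prop :=
  A !=set0 /\
  forall x y, A x -> A y -> exists z, [/\ A z, le x z & le y z].

Definition codirected (A : set T) : Prop :=
  A !=set0 /\
  forall x y, A x -> A y -> exists z, [/\ A z, le z x & le z y].

Definition is_join (A : set T) (j : T) : Prop :=
  (forall x, A x -> le x j) /\
  (forall y, (forall x, A x -> le x y) -> le j y).

Definition is_meet (A : set T) (m : T) : Prop :=
  (forall x, A x -> le m x) /\
  (forall y, (forall x, A x -> le y x) -> le y m).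

Definition has_binary_joins : Prop :=
  forall x y, exists j, is_join [set x; y] j.

Definition has_binary_meets : Prop :=
  forall x y, exists m, is_meet [set x; y] m.

(* The operations are chosen by [cid]; when [le] is antisymmetric, binary joins
   and meets are unique, so nothing depends on the choice. *)
Definition join_op (H : has_binary_joins) (x y : T) : T := sval (cid (H x y)).

Definition meet_op (H : has_binary_meets) (x y : T) : T := sval (cid (H x y)).

Definition distributive_lattice
    (Hm : has_binary_meets) (Hj : has_binary_joins) : Prop :=
  right_distributive (meet_op Hm) (join_op Hj).

End Orders.

Section Polarities.
Variables (K O : Type) (tri : K -> O -> Prop).

Definition upO (k : K) : set O := [set u | tri k u].
Definition downK (u : O) : set K := [set k | tri k u].

Definition leK (k l : K) : Prop := upO l `<=` upO k.
Definition leO (u v : O) : Prop := downK u `<=` downK v.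

Definition purified : Prop :=
  Relation_Definitions.order K leK /\ Relation_Definitions.order O leO.

Definition principal_downK (k : K) : set K := [set l | leK l k].
Definition principal_upO (u : O) : set O := [set v | leO u v].

Definition bi_dcpo : Prop :=
  [/\ purified,
      forall F : set K, codirected leK F -> exists m, is_meet leK F m,
      forall I : set O, directed leO I -> exists j, is_join leO I j,
      forall (k : K) (I : set O) (j : O), directed leO I -> is_join leO I j ->
        tri k j -> exists2 u, I u & tri k u
    & forall (F : set K) (m : K) (u : O), codirected leK F -> is_meet leK F m ->
        tri m u -> exists2 k, F k & tri k u].

Definition distributive_polarity : Prop :=
  forall (k l : K) (u v : O),
    (forall w, (principal_upO u `&` upO l) w -> tri k w) ->
    tri l v ->
    (forall m, (downK v `&` principal_downK k) m -> tri m u) ->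
    tri k u.

Definition btri (u : O) (k : K) : Prop := downK u `<=` principal_downK k.

Definition locally_compact : Prop :=
  forall (k : K) (u : O), tri k u ->
    exists (u' : O) (k' : K), [/\ tri k u', btri u' k' & tri k' u].

Definition bicontinuous : Prop :=
  [/\ locally_compact,
      forall u : O, directed leK (downK u)
    & forall k : K, codirected leO (upO k)].

End Polarities.

(* Main.v *)
(** Suppose that [O] is a distributive lattice, that (i)-(iii) hold for
    [k, l, u, v], and that [~ k <| u].  Zorn's lemma gives a [p >= u] maximal
    with [~ k <| p]; then [~ l <| p] by (i), so [~ v <= p] by (ii).
    Distributivity makes [p] prime, so the complement of the principal ideal
    of [p] is a Scott-open filter, hence of the form [{w | m <| w}]; then
    [m <= k], [m <| v] and [~ m <| u], against (iii).
    Conversely, distributivity of the bi-dcpo is a cut rule: if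
    [k <| a /\ (b \/ c)], then [k <| b' \/ c'] for some [b' << b] and
    [c' << c], and two cuts, on [b] and on [c], give
    [k <| (a /\ b) \/ (a /\ c)].  The statement about [K] is the one about [O]
    for the polarity with the two sides exchanged. *)
Require Import Defs.
From mathcomp Require Import ssreflect ssrfun ssrbool.
From mathcomp Require Import boolp classical_sets.
From Stdlib Require Import Relation_Definitions.

Local Open Scope classical_set_scope.

(** * Distributivity inequalities in a lattice *)

Section LatticeOrder.
Context {T : Type} {le : T -> T -> Prop}.
Hypothesis le_order : order T le.
Context {Hm : has_binary_meets le} {Hj : has_binary_joins le}.

Lemma meet_op_le x y : le (meet_op Hm x y) x /\ le (meet_op Hm x y) y.
Proof.
rewrite /meet_op; case: cid => m [/= lb _].
by split; apply: lb; [left|right].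
Qed.

Lemma le_meet_op x y z : le z x -> le z y -> le z (meet_op Hm x y).
Proof.
rewrite /meet_op; case: cid => m [/= _ glb] zx zy.
by apply: glb => _ [-> | ->].
Qed.

Lemma le_join_op x y : le x (join_op Hj x y) /\ le y (join_op Hj x y).
Proof.
rewrite /join_op; case: cid => j [/= ub _].
by split; apply: ub; [left|right].
Qed.

Lemma join_op_le x y z : le x z -> le y z -> le (join_op Hj x y) z.
Proof.
rewrite /join_op; case: cid => j [/= _ lub] xz yz.
by apply: lub => _ [-> | ->].
Qed.

Lemma join_op_mono x x' y y' :
  le x x' -> le y y' -> le (join_op Hj x y) (join_op Hj x' y').
Proof.
case: (le_order) => _ le_trans _ xx' yy'; have [xj yj] := le_join_op x' y'.
by apply: join_op_le; [exact: le_trans xx' xj|exact: le_trans yy' yj].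
Qed.

(** The converse inequality holds in every lattice. *)
Lemma distributive_latticeP :
  (forall x y z, le (meet_op Hm x (join_op Hj y z))
                    (join_op Hj (meet_op Hm x y) (meet_op Hm x z))) <->
  distributive_lattice Hm Hj.
Proof.
case: (le_order) => le_refl le_trans le_anti.
split=> [dist x y z|dist x y z]; last by rewrite dist; exact: le_refl.
apply: le_anti; first exact: dist.
by apply: join_op_le; (apply: le_meet_op; first exact: (meet_op_le _ _).1);
  (apply: le_trans; [exact: (meet_op_le _ _).2|]); apply le_join_op.
Qed.

(** Distributing the left side twice leaves terms below [x], apart from the meet of [z] and [y]. *)
Lemma distributive_lattice_dual_le :
  distributive_lattice Hm Hj ->
  forall x y z, le (meet_op Hm (join_op Hj x y) (join_op Hj x z))
                   (join_op Hj x (meet_op Hm y z)).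
Proof.
case: (le_order) => le_refl le_trans _ /distributive_latticeP dist x y z.
have [xj mj] := le_join_op x (meet_op Hm y z).
apply: (le_trans); first exact: dist.
apply: join_op_le; first by apply: le_trans xj; apply meet_op_le.
apply: (le_trans _ (meet_op Hm z (join_op Hj x y))).
  by apply: le_meet_op; apply meet_op_le.
apply: (le_trans); first exact: dist.
apply: join_op_le; first by apply: le_trans xj; apply meet_op_le.
by apply: le_trans mj; apply: le_meet_op; apply meet_op_le.
Qed.

End LatticeOrder.

Lemma distributive_lattice_flip {T : Type} {le : T -> T -> Prop}
    (le_order : order T le) (Hm : has_binary_meets le)
    (Hj : has_binary_joins le) :
  distributive_lattice Hm Hj <->
  distributive_lattice (le := fun x y => le y x) Hj Hm.
Proof.
case: (le_order) => le_refl le_trans le_anti.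
have ge_order : order T (fun x y => le y x).
  by split=> [x|x y z yx zy|x y yx xy];
    [exact: le_refl|exact: le_trans yx|exact: le_anti].
split=> dist.
- apply/(distributive_latticeP ge_order) => x y z.
  exact: (distributive_lattice_dual_le le_order dist).
- apply/(distributive_latticeP le_order) => x y z.
  exact: (distributive_lattice_dual_le ge_order dist).
Qed.

(** * Way-below relation, Scott-open filters, maximal elements *)

Section BicontinuousPolarity.
Context {K O : Type} {tri : K -> O -> Prop}.
Hypotheses (tri_bidcpo : bi_dcpo tri) (tri_bicont : bicontinuous tri).

Let leK_order : order K (leK tri). Proof. by case: tri_bidcpo => -[]. Qed.
Let leO_order : order O (leO tri). Proof. by case: tri_bidcpo => -[]. Qed.

(** In a bicontinuous bi-dcpo this is the usual way-below relation of the dcpo [O]. *)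
Definition way_below (u v : O) : Prop := exists2 k, btri tri u k & tri k v.

Lemma way_below_le u v : way_below u v -> leO tri u v.
Proof. by move=> [k uk kv] l lu; exact: (uk l lu) kv. Qed.

Lemma way_below_interpolant {k u} :
  tri k u -> exists2 w, tri k w & way_below w u.
Proof.
case: tri_bicont => lc _ _ /lc[w [l [kw wl lu]]].
by exists w => //; exists l.
Qed.

(** The witnesses [k1], [k2] have an upper bound [l] in the directed set [downK u]; any [w]
    interpolated between [l] and [u] bounds both elements. *)
Lemma directed_way_below u : directed (leO tri) [set w | way_below w u].
Proof.
case: tri_bicont => _ /(_ u)[[k ku] dir] _.
split; first by have [w _ wu] := way_below_interpolant ku; exists w.
move=> w1 w2 [k1 wk1 k1u] [k2 wk2 k2u].
have [l [lu k1l k2l]] := dir _ _ k1u k2u.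
have [w lw wu] := way_below_interpolant lu.
exists w; split=> // m mw.
- exact: wk1 mw _ (k1l _ lw).
- exact: wk2 mw _ (k2l _ lw).
Qed.

Lemma join_way_below u : is_join (leO tri) [set w | way_below w u] u.
Proof.
split=> [w|v ub k ku]; first exact: way_below_le.
by have [w kw wu] := way_below_interpolant ku; exact: ub kw.
Qed.

Definition scott_open_filter (F : set O) : Prop :=
  [/\ codirected (leO tri) F,
      forall u v, F u -> leO tri u v -> F v
    & forall (I : set O) j, directed (leO tri) I -> is_join (leO tri) I j ->
        F j -> exists2 i, I i & F i].

(** A representation of Hofmann-Mislove type: Scott-openness puts a way-below approximant of each
    member of [F] into [F], and the elements of [K] above such approximants have a codirected meet
    that represents [F]. *)
Lemma scott_open_filter_upO F :
  scott_open_filter F -> exists k, forall u, tri k u <-> F u.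
Proof.
move=> [[[u0 Fu0] codir] up op].
have below u : F u -> exists w k, [/\ F w, btri tri w k & tri k u].
  move=> Fu; have [w [k wk ku] Fw] :=
    op _ _ (directed_way_below u) (join_way_below u) Fu.
  by exists w, k.
pose G := [set k | exists2 w, F w & btri tri w k].
have G_codirected : codirected (leK tri) G.
  split; first by have [w [k [Fw wk _]]] := below _ Fu0; exists k, w.
  move=> k1 k2 [w1 Fw1 wk1] [w2 Fw2 wk2].
  have [z [Fz zw1 zw2]] := codir _ _ Fw1 Fw2.
  have [w [k [Fw wk kz]]] := below _ Fz.
  exists k; split; first by exists w.
  - exact: wk1 (zw1 _ kz).
  - exact: wk2 (zw2 _ kz).
case: tri_bidcpo => _ meetK _ _ compactK.
have [m mG] := meetK _ G_codirected; exists m => u; split.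
- move=> /(compactK _ _ _ G_codirected mG)[k [w Fw wk] ku].
  by apply: (up w) => // n nw; exact: wk nw _ ku.
- move=> /below[w [k [Fw wk ku]]].
  by apply: (mG.1 k) ku; exists w.
Qed.

(** Zorn's lemma applies because a directed join that satisfies [tri k] has a member that already
    does. *)
Lemma maximal_not_above {k u} : ~ tri k u ->
  exists p, [/\ leO tri u p, ~ tri k p &
    forall q, leO tri p q -> ~ tri k q -> leO tri q p].
Proof.
move=> nku; case: (leO_order) => le_refl le_trans _.
pose P p := leO tri u p /\ ~ tri k p.
pose R (p q : {p | P p}) := `[< leO tri (sval p) (sval q) >].
have Pu : P u by split=> //; exact: le_refl.
have [|||[p [up nkp]] p_max] := @ZL_preorder _ (exist P u Pu) R.
- by move=> p; apply/asboolP; exact: le_refl.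
- by move=> p q r /asboolP pq /asboolP qr; apply/asboolP; exact: le_trans qr.
- move=> A totA; have [[a Aa]|A0] := pselect (A !=set0); last first.
    (* The empty chain is not directed; [u] itself bounds it. *)
    by exists (exist P u Pu) => s As; case: A0; exists s.
  pose I := [set p | exists2 a, A a & sval a = p].
  have I_directed : directed (leO tri) I.
    split; first by exists (sval a), a.
    move=> _ _ [b Ab <-] [c Ac <-].
    have [/asboolP bc|/asboolP cb] := totA _ _ Ab Ac.
    - by exists (sval c); split; [exists c| |exact: le_refl].
    - by exists (sval b); split; [exists b|exact: le_refl|].
  case: tri_bidcpo => _ _ joinO compactO _.
  have [j jI] := joinO _ I_directed.
  have Ij b : A b -> leO tri (sval b) j by move=> Ab; apply: jI.1; exists b.
  have Pj : P j.
    split; first exact: le_trans (svalP a).1 (Ij _ Aa).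
    move=> /(compactO _ _ _ I_directed jI)[_ [b _ <-]].
    exact: (svalP b).2.
  by exists (exist P j Pj) => b Ab; apply/asboolP; exact: Ij.
exists p; split=> // q pq nkq.
have Pq : P q by split=> //; exact: le_trans pq.
by have /asboolP := p_max (exist P q Pq) (introT (asboolP _) pq).
Qed.

(** * Distributivity of the polarity and of the lattice [O] *)

Section LatticeOfOpens.
Variables (Hm : has_binary_meets (leO tri)) (Hj : has_binary_joins (leO tri)).

Local Notation "u `/\` v" := (meet_op Hm u v) (at level 48).
Local Notation "u `\/` v" := (join_op Hj u v) (at level 50).

Lemma tri_meet_op k u v : tri k u -> tri k v -> tri k (u `/\` v).
Proof.
case: tri_bicont => _ _ /(_ k)[_ codir] ku kv.
have [w [kw wu wv]] := codir _ _ ku kv.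
exact: (le_meet_op _ _ _ wu wv) kw.
Qed.

(** The joins of approximants of [u] and [v] form a directed set with join the join of [u] and [v],
    so [k] is already related to one of them. *)
Lemma tri_join_op_way_below k u v : tri k (u `\/` v) ->
  exists u' v', [/\ way_below u' u, way_below v' v & tri k (u' `\/` v')].
Proof.
case: (leO_order) => le_refl le_trans _ kuv.
pose I := [set w | exists u' v',
  [/\ way_below u' u, way_below v' v & u' `\/` v' = w]].
have I_directed : directed (leO tri) I.
  have [[u0 u0u] diru] := directed_way_below u.
  have [[v0 v0v] dirv] := directed_way_below v.
  split; first by exists (u0 `\/` v0), u0, v0.
  move=> _ _ [u1 [v1 [u1u v1v <-]]] [u2 [v2 [u2u v2v <-]]].
  have [u3 [u3u u13 u23]] := diru _ _ u1u u2u.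
  have [v3 [v3v v13 v23]] := dirv _ _ v1v v2v.
  exists (u3 `\/` v3); split; first by exists u3, v3.
  - exact: (join_op_mono leO_order _ _ _ _ u13 v13).
  - exact: (join_op_mono leO_order _ _ _ _ u23 v23).
have I_join : is_join (leO tri) I (u `\/` v).
  split=> [_ [u' [v' [/way_below_le u'u /way_below_le v'v <-]]]|y ub].
    exact: (join_op_mono leO_order _ _ _ _ u'u v'v).
  have [[u0 u0u] _] := directed_way_below u.
  have [[v0 v0v] _] := directed_way_below v.
  apply: (join_op_le (le := leO tri)).
  - apply: (join_way_below u).2 => u' u'u.
    by apply: le_trans (le_join_op u' v0).1 _; apply: ub; exists u', v0.
  - apply: (join_way_below v).2 => v' v'v.
    by apply: le_trans (le_join_op u0 v').2 _; apply: ub; exists u0, v'.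
case: tri_bidcpo => _ _ _ compactO _.
have [_ [u' [v' [u'u v'v <-]]] kw] := compactO _ _ _ I_directed I_join kuv.
by exists u', v'.
Qed.

Lemma distributive_polarity_lattice :
  distributive_polarity tri -> distributive_lattice Hm Hj.
Proof.
move=> cut; case: (leO_order) => _ le_trans _.
apply/(distributive_latticeP leO_order) => a b c k kabc.
have [abca abcbc] := meet_op_le (Hm := Hm) a (b `\/` c).
have ka := abca _ kabc.
have [b' [c' [[l b'l lb] [l' c'l' l'c] kbc]]] :=
  tri_join_op_way_below _ _ _ (abcbc _ kabc).
set u := _ `\/` _.
have [abu acu] : leO tri (a `/\` b) u /\ leO tri (a `/\` c) u.
  exact: le_join_op.
apply: (cut k l u b) => // [w [uw lw]|m [mb mk]]; last first.
  by apply: abu; apply: tri_meet_op => //; exact: mk.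
apply: (cut k l' w c) => // [w' [ww' l'w']|m [mc mk]]; last first.
  by apply: uw; apply: acu; apply: tri_meet_op => //; exact: mk.
(* Both cuts have left [w'] above [w], with [tri l w] and [tri l' w']; these place [b'] and [c']
   below [w']. *)
have bcw' : leO tri (b' `\/` c') w'.
  apply: (join_op_le (le := leO tri)) => n.
  - by move=> /b'l; apply; exact: ww'.
  - by move=> /c'l'; apply.
exact: bcw' kbc.
Qed.

Lemma distributive_lattice_polarity :
  distributive_lattice Hm Hj -> distributive_polarity tri.
Proof.
move=> dist k l u v kw lv mu; apply: contrapT => nku.
case: (leO_order) => le_refl le_trans _.
have [p [up nkp p_max]] := maximal_not_above nku.
have kjoin x : ~ leO tri x p -> tri k (p `\/` x).
  have [pj xj] := le_join_op (Hj := Hj) p x.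
  move=> nxp; apply: contrapT => nk; apply: nxp.
  exact: le_trans xj (p_max _ pj nk).
(* Otherwise [k] is related to the meet of two joins with [p], which by distributivity lies below
   [p]. *)
have prime x y : ~ leO tri x p -> ~ leO tri y p -> ~ leO tri (x `/\` y) p.
  move=> nxp nyp xyp; apply: nkp.
  apply: (join_op_le _ _ _ (le_refl p) xyp).
  apply: (distributive_lattice_dual_le leO_order dist).
  by apply: tri_meet_op; exact: kjoin.
have nvp : ~ leO tri v p.
  by move=> vp; apply: nkp; apply: kw; split=> //; exact: vp.
have [m mE] : exists m, forall w, tri m w <-> ~ leO tri w p.
  apply: scott_open_filter_upO; split.
  - split; first by exists v.
    move=> x y nxp nyp; have [mx my] := meet_op_le (Hm := Hm) x y.
    by exists (x `/\` y); split=> //; exact: prime.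
  - by move=> x y nxp xy yp; apply: nxp; exact: le_trans yp.
  - move=> I j _ jI njp; apply: contrapT => nI; apply: njp.
    apply: jI.2 => i Ii; apply: contrapT => nip.
    by apply: nI; exists i.
have /mE : tri m u; last by apply.
apply: mu; split; first exact/mE.
(* This is [leK tri m k]: an element related to [k] cannot lie below [p]. *)
by move=> w kw'; apply/mE => wp; apply: nkp; exact: wp.
Qed.

Lemma distributive_polarityP :
  distributive_polarity tri <-> distributive_lattice Hm Hj.
Proof.
split; first exact: distributive_polarity_lattice.
exact: distributive_lattice_polarity.
Qed.

End LatticeOfOpens.

End BicontinuousPolarity.

(** * Exchanging the two sides of a polarity *)

Section Duality.
Context {K O : Type} (tri : K -> O -> Prop).

Definition dual_polarity (u : O) (k : K) : Prop := tri k u.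

Lemma bi_dcpo_dual : bi_dcpo tri -> bi_dcpo dual_polarity.
Proof.
move=> [[[Kr Kt Ka] [Or Ot Oa]] meetK joinO compactO compactK].
split=> //.
- split; split=> // [x y z yx zy|x y yx xy].
  + exact: Ot zy yx.
  + exact: Oa xy yx.
  + exact: Kt zy yx.
  + exact: Ka xy yx.
- by move=> u F m; exact: compactK.
- by move=> I j k; exact: compactO.
Qed.

Lemma bicontinuous_dual : bicontinuous tri -> bicontinuous dual_polarity.
Proof.
move=> [lc dirK codirO]; split=> // u k /lc[v [l [kv vl lu]]].
(* [btri] is self-dual: [btri v l] says that [tri n v] and [tri l w] imply [tri n w]. *)
by exists l, v; split=> // w lw n nv; exact: (vl _ nv) lw.
Qed.

(** The exchange swaps [k] with [u] and [l] with [v], hence (i) with (iii), and fixes (ii). *)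
Lemma distributive_polarity_dual :
  distributive_polarity tri <-> distributive_polarity dual_polarity.
Proof.
split=> cut.
- move=> u v k l i vl iii; apply: (cut k l u v) => // [w [uw lw]|m [mv mk]].
  + by apply: iii.
  + by apply: i.
- move=> k l u v i lv iii; apply: (cut u v k l) => // [m [km mv]|w [lw wu]].
  + by apply: iii.
  + by apply: i.
Qed.

End Duality.

Theorem theorem6p19 (K O : Type) (tri : K -> O -> Prop)
    (tri_bidcpo : bi_dcpo tri) (tri_bicont : bicontinuous tri) :
  (forall (meetsO : has_binary_meets (leO tri))
          (joinsO : has_binary_joins (leO tri)),
     distributive_polarity tri <-> distributive_lattice meetsO joinsO) /\
  (forall (joinsK : has_binary_joins (leK tri))
          (meetsK : has_binary_meets (leK tri)),
     distributive_polarity tri <-> distributive_lattice meetsK joinsK).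
Proof.
split=> [meetsO joinsO|joinsK meetsK].
  exact: distributive_polarityP.
have leK_order : order K (leK tri) by case: tri_bidcpo => -[].
apply: (iff_trans (distributive_polarity_dual tri)).
(* [leO] of the dual polarity is the reverse of [leK tri], so joins and meets of [K] change
   places. *)
apply: (iff_trans _ (iff_sym (distributive_lattice_flip leK_order _ _))).
exact: (distributive_polarityP (bi_dcpo_dual _ tri_bidcpo)
  (bicontinuous_dual _ tri_bicont) joinsK meetsK).
Qed.
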